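(* Let $a=(a_1,\dots,a_n)$ be a tuple of distinct complex numbers. Then: (a) $R_a$ has basis $\{t^k,(t-a_1)^{-l},\dots,(t-a_n)^{-l}\mid k\in\mathbb{Z}_+,\,l\in\mathbb{N}\}$ over $\mathbb{C}$; (b) $\mathscr{V}_a$ has basis $\{t^k\partial,(t-a_1)^{-l}\partial,\dots,(t-a_n)^{-l}\partial\mid k\in\mathbb{Z}_+,\,l\in\mathbb{N}\}$ over $\mathbb{C}$; (c) the group $R_a^*$ of invertible elements of $R_a$ is $R_a^*=\{c\prod_{i=1}^n(t-a_i)^{k_i}\mid c\in\mathbb{C}^*,\,k_i\in\mathbb{Z}\}$.
   Context: $\mathbb{N}=\{1,2,\dots\}$, $\mathbb{Z}_+=\{0,1,2,\dots\}$, $\mathbb{C}^*=\mathbb{C}\setminus\{0\}$, $n\in\mathbb{N}$. $R_a$ is the subalgebra of $\mathbb{C}(t)$ generated by $t,(t-a_1)^{-1},\dots,(t-a_n)^{-1}$, and $\mathscr{V}_a=\operatorname{Der}(R_a)$ is the Lie algebra of $\mathbb{C}$-derivations of $R_a$; $\partial=d/dt$. *)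

(* Defs.v *)
From HB Require Import structures.
From mathcomp Require Import all_boot all_order all_algebra.
From mathcomp Require Import all_classical all_reals.
From mathcomp Require Import complex ring.

Set Implicit Arguments.
Unset Strict Implicit.
Unset Printing Implicit Defensive.

Import Order.TTheory GRing.Theory Num.Theory.
Import generic_quotient.

Local Open Scope classical_set_scope.
Local Open Scope ring_scope.

(* The indexed form of "{b i | i in I} is a basis of V": in particular it
   implies that b is injective. *)
Definition is_basis (K : fieldType) (V : lmodType K) (I : eqType) (b : I -> V) :=
  (forall (s : seq I) (c : I -> K), uniq s ->
     \sum_(i <- s) c i *: b i = 0 -> forall i, i \in s -> c i = 0)
  /\ (forall v : V, exists (s : seq I) (c : I -> K),
        v = \sum_(i <- s) c i *: b i).

Section GeneratedSubalgebra.
Variables (K : fieldType) (A : comAlgType K).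
Implicit Types (S : set A) (x y : A).

Definition gen_subalg S : {pred A} :=
  fun x => `[< forall B : {pred A},
                 subalg_closed B -> (forall y, S y -> y \in B) -> x \in B >].

Lemma gen_subalgP S x :
  reflect (forall B : {pred A},
             subalg_closed B -> (forall y, S y -> y \in B) -> x \in B)
          (x \in gen_subalg S).
Proof. exact: asboolP. Qed.

Lemma mem_gen_subalg S y : S y -> y \in gen_subalg S.
Proof. by move=> Sy; apply/gen_subalgP => B _; apply. Qed.

Lemma gen_subalg_closed S : subalg_closed (gen_subalg S).
Proof.
split.
- by apply/gen_subalgP => B [].
- move=> c x y /gen_subalgP hx /gen_subalgP hy; apply/gen_subalgP => B hB hS.
  by case: (hB) => _ + _; apply; [apply: hx | apply: hy].
- move=> x y /gen_subalgP hx /gen_subalgP hy; apply/gen_subalgP => B hB hS.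
  by case: (hB) => _ _; apply; [apply: hx | apply: hy].
Qed.

HB.instance Definition _ S :=
  GRing.isSubalgClosed.Build K A (gen_subalg S) (gen_subalg_closed S).

Record subalg_of S :=
  SubalgOf { subalg_val :> A; subalg_valP : subalg_val \in gen_subalg S }.

HB.instance Definition _ S := [isSub for @subalg_val S].
HB.instance Definition _ S := [Choice of subalg_of S by <:].
HB.instance Definition _ S :=
  [SubChoice_isSubComNzRing of subalg_of S by <:].
HB.instance Definition _ S := [SubZmodule_isSubLmodule of subalg_of S by <:].
HB.instance Definition _ S :=
  [SubNzRing_SubLmodule_isSubLalgebra of subalg_of S by <:].
HB.instance Definition _ S := [SubLalgebra_isSubAlgebra of subalg_of S by <:].

End GeneratedSubalgebra.

Section Derivations.
Variables (K : fieldType) (A : comAlgType K).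

Definition is_derivation : {pred A -> A} :=
  fun D => `[< linear D /\ (forall x y, D (x * y) = D x * y + x * D y) >].

Lemma is_derivationP (D : A -> A) :
  reflect (linear D /\ (forall x y, D (x * y) = D x * y + x * D y))
          (D \in is_derivation).
Proof. exact: asboolP. Qed.

Lemma is_derivation_submod_closed : submod_closed is_derivation.
Proof.
split.
- apply/is_derivationP; split=> [c x y|x y].
  + by rewrite scaler0 addr0.
  + by rewrite mul0r mulr0 addr0.
- move=> c D E /is_derivationP[Dl DM] /is_derivationP[El EM].
  apply/is_derivationP; split=> [d x y|x y].
  + rewrite !fctE Dl El scalerDr !scalerA mulrC -!scalerA.
    by rewrite [d *: (_ + _)]scalerDr addrACA.
  + rewrite !fctE DM EM scalerDr mulrDl mulrDr -scalerAl -scalerAr.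
    by rewrite addrACA.
Qed.

HB.instance Definition _ :=
  GRing.isSubmodClosed.Build K (A -> A) is_derivation
    is_derivation_submod_closed.

(* Only the vector-space structure of Der A is set up; the bracket is not
   needed. *)
Record Der := MkDer { der_fun :> A -> A; derP : der_fun \in is_derivation }.

HB.instance Definition _ := [isSub for der_fun].
HB.instance Definition _ := [Choice of Der by <:].
HB.instance Definition _ := [SubChoice_isSubLmodule of Der by <:].

Lemma der_mul_subproof (r : A) (D : Der) :
  (fun x => r * D x) \in is_derivation.
Proof.
have /is_derivationP[Dl DM] := derP D.
apply/is_derivationP; split=> [c x y|x y].
- by rewrite Dl mulrDr -scalerAr.
- by rewrite DM mulrDr mulrA mulrCA.
Qed.

Definition der_mul (r : A) (D : Der) : Der := MkDer (der_mul_subproof r D).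

End Derivations.

Definition invertible {A : comNzRingType} : set A :=
  [set x | exists y, x * y = 1].

Fact divf_cross (F : fieldType) (p q n d : F) :
  q != 0 -> d != 0 -> p / q = n / d -> p * d = n * q.
Proof. by move=> q0 d0 /eqP; rewrite eqr_div // => /eqP. Qed.

Fact cross_divf (F : fieldType) (p q n d : F) :
  q != 0 -> d != 0 -> p * d = n * q -> p / q = n / d.
Proof. by move=> q0 d0 /eqP e; apply/eqP; rewrite eqr_div. Qed.

Fact frac_addE (F : fieldType) (c p n q d : F) : q != 0 -> d != 0 ->
  c * (p / q) + n / d = (c * p * d + n * q) / (q * d).
Proof. by move=> q0 d0; field; rewrite q0 d0. Qed.

Fact frac_mulE (F : fieldType) (p n q d : F) : q != 0 -> d != 0 ->
  (p / q) * (n / d) = (p * n) / (q * d).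
Proof. by move=> q0 d0; field; rewrite q0 d0. Qed.

Fact frac_deriv_addE (F : fieldType) (c p p' n n' q q' d d' : F) :
  q != 0 -> d != 0 ->
  ((c * p' * d + c * p * d' + (n' * q + n * q')) * (q * d)
    - (c * p * d + n * q) * (q' * d + q * d')) / (q * d) ^+ 2
  = c * ((p' * q - p * q') / q ^+ 2) + (n' * d - n * d') / d ^+ 2.
Proof. by move=> q0 d0; field; rewrite q0 d0. Qed.

Fact frac_deriv_mulE (F : fieldType) (p p' n n' q q' d d' : F) :
  q != 0 -> d != 0 ->
  ((p' * n + p * n') * (q * d) - p * n * (q' * d + q * d')) / (q * d) ^+ 2
  = (p' * q - p * q') / q ^+ 2 * (n / d)
    + p / q * ((n' * d - n * d') / d ^+ 2).
Proof. by move=> q0 d0; field; rewrite q0 d0. Qed.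

Definition ratfun (K : fieldType) := {fraction {poly K}}.
HB.instance Definition _ (K : fieldType) := GRing.Field.on (ratfun K).

Section RationalFunctions.
Variable K : fieldType.
Implicit Types (p q : {poly K}) (x y : ratfun K).

Notation "p %:F" := (tofrac p : ratfun K).

Definition ratfun_scale (c : K) x : ratfun K := c%:P%:F * x.

Fact ratfun_scalerA c d x :
  ratfun_scale c (ratfun_scale d x) = ratfun_scale (c * d) x.
Proof. by rewrite /ratfun_scale mulrA -tofracM -polyCM. Qed.

Fact ratfun_scale1r : left_id 1 ratfun_scale.
Proof. by move=> x; rewrite /ratfun_scale tofrac1 mul1r. Qed.

Fact ratfun_scalerDr : right_distributive ratfun_scale +%R.
Proof. by move=> c x y; rewrite /ratfun_scale mulrDr. Qed.

Fact ratfun_scalerDl x : {morph ratfun_scale^~ x : c d / c + d}.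
Proof. by move=> c d; rewrite /ratfun_scale polyCD tofracD mulrDl. Qed.

HB.instance Definition _ := GRing.Zmodule_isLmodule.Build K (ratfun K)
  ratfun_scalerA ratfun_scale1r ratfun_scalerDr ratfun_scalerDl.

Fact ratfun_scalerAl (c : K) x y : c *: (x * y) = c *: x * y.
Proof. exact: mulrA. Qed.

HB.instance Definition _ :=
  GRing.Lmodule_isLalgebra.Build K (ratfun K) ratfun_scalerAl.
HB.instance Definition _ := GRing.Lalgebra_isComAlgebra.Build K (ratfun K).

Definition ratX : ratfun K := 'X%:F.

(* d/dt, by the quotient rule applied to the chosen representative of the
   fraction; [ratderivE] shows that the choice does not matter. *)
Definition ratderiv x : ratfun K :=
  let r : {ratio {poly K}} := repr x in
  ((\n_r)^`() * \d_r - \n_r * (\d_r)^`())%:F / ((\d_r) ^+ 2)%:F.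

Lemma ratfun_repr x : exists p q, [/\ q != 0, x = p%:F / q%:F &
  ratderiv x = (p^`() * q - p * q^`())%:F / (q ^+ 2)%:F].
Proof.
exists (\n_(repr x : {ratio {poly K}})), (\d_(repr x : {ratio {poly K}})).
have d0 := denom_ratioP (repr x : {ratio {poly K}}).
split=> //.
have d0' : tofrac (\d_(repr x : {ratio {poly K}})) != 0 by rewrite tofrac_eq0.
apply: (mulIf d0'); rewrite (mulfVK d0').
rewrite -[X in X * _ = _](reprK x); unlock tofrac.
rewrite -[LHS]FracField.pi_mul; apply/eqmodP => /=.
rewrite /FracField.mulf !numden_Ratio ?mulr1 ?oner_neq0 //.
by rewrite FracField.equivfE !numden_Ratio ?oner_neq0 // mulr1 mulrC.
Qed.

Lemma ratderivE p q : q != 0 ->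
  ratderiv (p%:F / q%:F) = (p^`() * q - p * q^`())%:F / (q ^+ 2)%:F.
Proof.
move=> q0; have [n [d [d0 e ->]]] := ratfun_repr (p%:F / q%:F).
have q0' : tofrac q != 0 by rewrite tofrac_eq0.
have d0' : tofrac d != 0 by rewrite tofrac_eq0.
have {}e : p * d = n * q.
  apply/eqP; rewrite -tofrac_eq !tofracM; apply/eqP.
  exact: (divf_cross q0' d0' e).
have e' : p^`() * d + p * d^`() = n^`() * q + n * q^`().
  by rewrite -!derivM e.
have q2 : tofrac (q ^+ 2) != 0 by rewrite tofrac_eq0 expf_neq0.
have d2 : tofrac (d ^+ 2) != 0 by rewrite tofrac_eq0 expf_neq0.
apply: (cross_divf d2 q2); rewrite -!tofracM; congr tofrac.
have -> : (n^`() * d - n * d^`()) * q ^+ 2 =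
   d * q * (n^`() * q + n * q^`()) - (n * q) * (d * q^`()  + q * d^`()) by ring.
by rewrite -e' -e; ring.
Qed.

Lemma ratderiv_linear : linear ratderiv.
Proof.
move=> c x y.
have [p [q [q0 -> _]]] := ratfun_repr x; have [n [d [d0 -> _]]] := ratfun_repr y.
have q0' : tofrac q != 0 by rewrite tofrac_eq0.
have d0' : tofrac d != 0 by rewrite tofrac_eq0.
have qd0 : q * d != 0 by rewrite mulf_neq0.
have -> : c *: (p%:F / q%:F) + n%:F / d%:F
          = (c%:P * p * d + n * q)%:F / (q * d)%:F.
  rewrite tofracD !tofracM; exact: (frac_addE _ _ _ q0' d0').
rewrite !ratderivE // !derivM !derivD !derivM derivC.
rewrite mul0r add0r.
rewrite !tofracXn !tofracB !(tofracD, tofracM).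
exact: (frac_deriv_addE _ _ _ _ _ _ _ q0' d0').
Qed.

Lemma ratderivM x y : ratderiv (x * y) = ratderiv x * y + x * ratderiv y.
Proof.
have [p [q [q0 -> _]]] := ratfun_repr x; have [n [d [d0 -> _]]] := ratfun_repr y.
have q0' : tofrac q != 0 by rewrite tofrac_eq0.
have d0' : tofrac d != 0 by rewrite tofrac_eq0.
have qd0 : q * d != 0 by rewrite mulf_neq0.
have -> : (p%:F / q%:F) * (n%:F / d%:F) = (p * n)%:F / (q * d)%:F.
  rewrite !tofracM; exact: (frac_mulE _ _ q0' d0').
rewrite !ratderivE // !derivM.
rewrite !tofracXn !tofracB !(tofracD, tofracM).
exact: (frac_deriv_mulE _ _ _ _ _ _ q0' d0').
Qed.

End RationalFunctions.

Section PointedLine.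
Variables (K : fieldType) (n : nat) (a : n.-tuple K).

Definition lin_ratfun (i : 'I_n) : ratfun K := ratX K - (tnth a i)%:A.

Lemma lin_ratfunE i : lin_ratfun i = tofrac ('X - (tnth a i)%:P).
Proof. by rewrite tofracB /lin_ratfun; congr (_ - _); exact: mulr1. Qed.

Definition Ra_gens : set (ratfun K) :=
  ratX K |` range (fun i => (lin_ratfun i)^-1).

Notation Ra := (subalg_of Ra_gens).

Lemma ratderiv1 : ratderiv (1 : ratfun K) = 0.
Proof.
have -> : (1 : ratfun K) = tofrac 1 / tofrac 1 by rewrite tofrac1 divr1.
rewrite (ratderivE _ (oner_neq0 _)) derivC mul0r mulr0 subr0.
by rewrite tofrac0 mul0r.
Qed.

Lemma ratderiv_ratX : ratderiv (ratX K) = 1.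
Proof.
have -> : ratX K = tofrac 'X / tofrac 1 by rewrite tofrac1 divr1.
rewrite (ratderivE _ (oner_neq0 _)) derivX derivC mulr0 subr0 mulr1 expr1n.
by rewrite tofrac1 divr1.
Qed.

Lemma ratderiv_lin_ratfunV i :
  ratderiv (lin_ratfun i)^-1 = - ((lin_ratfun i)^-1 * (lin_ratfun i)^-1).
Proof.
rewrite lin_ratfunE.
set q := 'X - _; have q0 : q != 0 by rewrite /q polyXsubC_eq0.
have -> : (tofrac q)^-1 = tofrac 1 / tofrac q by rewrite tofrac1 div1r.
rewrite (ratderivE _ q0) derivC mul0r mul1r sub0r derivB derivX derivC subr0.
by rewrite tofracN tofrac1 expr2 tofracM mulN1r div1r invfM.
Qed.

Lemma ratderiv_gen_subalg x :
  x \in gen_subalg Ra_gens -> ratderiv x \in gen_subalg Ra_gens.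
Proof.
move=> /gen_subalgP xP.
pose B : {pred ratfun K} := fun x =>
  (x \in gen_subalg Ra_gens) && (ratderiv x \in gen_subalg Ra_gens).
suff /andP[] : x \in B by [].
have [c1 cl cM] := gen_subalg_closed Ra_gens.
apply: xP; first split.
- rewrite unfold_in c1 /=.
  by rewrite ratderiv1 rpred0.
- move=> c y z /andP[y1 y2] /andP[z1 z2]; rewrite unfold_in cl //=.
  by rewrite ratderiv_linear cl.
- move=> y z /andP[y1 y2] /andP[z1 z2]; rewrite unfold_in cM //=.
  by rewrite ratderivM rpredD // cM.
- move=> y [->|[i _ <-]]; rewrite unfold_in; apply/andP; split.
  + by apply: mem_gen_subalg; left.
  + by rewrite ratderiv_ratX.
  + by apply: mem_gen_subalg; right; exists i.
  + rewrite ratderiv_lin_ratfunV rpredN cM //;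
      by apply: mem_gen_subalg; right; exists i.
Qed.

Definition Ra_deriv (x : Ra) : Ra :=
  SubalgOf (ratderiv_gen_subalg (subalg_valP x)).

Lemma Ra_deriv_is_derivation : Ra_deriv \in @is_derivation K Ra.
Proof.
apply/is_derivationP; split=> [c x y|x y]; apply: val_inj => /=.
- exact: ratderiv_linear.
- exact: ratderivM.
Qed.

Definition d_dt : Der Ra := MkDer Ra_deriv_is_derivation.

(* [inl k] stands for t^k and [inr (i, l)] for (t - a_i)^-(l+1). *)
Definition Ra_monom (j : nat + 'I_n * nat) : ratfun K :=
  match j with
  | inl k => ratX K ^+ k
  | inr (i, l) => lin_ratfun i ^- l.+1
  end.

Lemma Ra_monom_subproof j : Ra_monom j \in gen_subalg Ra_gens.
Proof.
case: j => [k|[i l]] /=.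
- by apply: rpredX; apply: mem_gen_subalg; left.
- by rewrite -exprVn; apply: rpredX; apply: mem_gen_subalg; right; exists i.
Qed.

Definition Ra_basis (j : nat + 'I_n * nat) : Ra :=
  SubalgOf (Ra_monom_subproof j).

Definition Va_basis (j : nat + 'I_n * nat) : Der Ra :=
  der_mul (Ra_basis j) d_dt.

End PointedLine.

Notation Ra a := (subalg_of (Ra_gens a)).
Notation Va a := (Der (Ra a)).

(* Main.v *)
(* (a) The span of the monomials is stable under multiplication by t and, by
   partial fractions, by each (t - a_i)^-1, so it contains R_a.  In a vanishing
   combination with largest pole order m at a_i, multiplying by (t - a_i)^m
   exhibits the coefficient of (t - a_i)^-m as (t - a_i) times an element
   regular at a_i, so it is 0; what remains is a polynomial relation.
   (b) A derivation of R_a killing t kills all generators, so D = D(t) d/dt and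
   the claim reduces to (a).
   (c) Every element of R_a is p / prod (t - a_i)^m; for a unit, p divides a
   product of the t - a_i, hence is itself such a product up to a constant. *)
Require Import Defs.
From HB Require Import structures.
From mathcomp Require Import all_boot all_order all_algebra.
From mathcomp Require Import all_classical all_reals.
From mathcomp Require Import complex.
Set Implicit Arguments.
Unset Strict Implicit.

Import Order.TTheory GRing.Theory Num.Theory.
Local Open Scope classical_set_scope.
Local Open Scope ring_scope.

(** * Linear spans of indexed families *)

Section LinearSpan.
Variables (K : fieldType) (V : lmodType K) (I : eqType) (b : I -> V).

(** Lists of coefficient-index pairs may repeat an index, so a sum of two combinations is just a
    concatenation. *)
Definition lin_span : {pred V} :=
  fun v => `[< exists l : seq (K * I), v = \sum_(p <- l) p.1 *: b p.2 >].

Lemma lin_span_gen i : b i \in lin_span.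
Proof. by apply/asboolP; exists [:: (1, i)]; rewrite big_seq1 scale1r. Qed.

Lemma lin_span_submod_closed : submod_closed lin_span.
Proof.
split=> [|c x y /asboolP[lx ->] /asboolP[ly ->]]; apply/asboolP.
  by exists [::]; rewrite big_nil.
exists ([seq (c * p.1, p.2) | p <- lx] ++ ly).
rewrite big_cat big_map scaler_sumr; congr (_ + _).
by apply: eq_bigr => p _; rewrite scalerA.
Qed.

HB.instance Definition _ :=
  GRing.isSubmodClosed.Build K V lin_span lin_span_submod_closed.

Lemma lin_span_linear (W : lmodType K) (S : submodClosed W) (f : V -> W) :
  linear f -> (forall i, f (b i) \in S) ->
  forall v, v \in lin_span -> f v \in S.
Proof.
move=> fl fS v /asboolP[l ->].
have f0 : f 0 = 0.
  by have := fl (-1) 0 0; rewrite scaler0 add0r scaleN1r addNr.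
elim: l => [|p l IHl]; first by rewrite big_nil f0 rpred0.
by rewrite big_cons fl rpredD // rpredZ.
Qed.

(** Repeated indices are merged: the coefficient of [i] is the sum of all those attached to [i] in
    the list. *)
Lemma lin_spanP v : v \in lin_span ->
  exists (s : seq I) (c : I -> K), v = \sum_(i <- s) c i *: b i.
Proof.
move=> /asboolP[l ->]; pose s := undup [seq p.2 | p <- l].
exists s, (fun i => \sum_(p <- l | p.2 == i) p.1).
under [RHS]eq_bigr => i _ do rewrite scaler_suml big_mkcond.
rewrite exchange_big /= big_seq [RHS]big_seq.
apply: eq_bigr => p pl.
have ps : p.2 \in s by rewrite mem_undup map_f.
rewrite (bigD1_seq p.2) ?undup_uniq //= eqxx big1 ?addr0 // => i.
by rewrite eq_sym => /negPf ->.
Qed.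

End LinearSpan.

(** * Partial fractions: the monomials span [R_a] *)

Section SubalgebraOfFractions.
Variables (K : fieldType) (n : nat) (a : n.-tuple K).
Implicit Types (i j : 'I_n) (x y : ratfun K) (p q : {poly K}).

Local Notation u := (lin_ratfun a).
Local Notation span := (lin_span (Ra_monom a)).

Lemma lin_ratfun_neq0 i : u i != 0.
Proof. by rewrite lin_ratfunE tofrac_eq0 polyXsubC_eq0. Qed.

Lemma ratX_lin_ratfun i : ratX K = u i + (tnth a i)%:A.
Proof. by rewrite /lin_ratfun subrK. Qed.

Lemma mem_span_ratX k : ratX K ^+ k \in span.
Proof. exact: (lin_span_gen (Ra_monom a) (inl k)). Qed.

Lemma mem_span_pole i l : u i ^- l \in span.
Proof.
case: l => [|l]; last exact: (lin_span_gen (Ra_monom a) (inr (i, l))).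
by rewrite expr0 invr1; apply: (mem_span_ratX 0).
Qed.

(** On a pole at [a_i], writing [t = u i + a_i] gives a pole of order one less plus a multiple of
    the same pole. *)
Lemma span_mul_ratX x : x \in span -> ratX K * x \in span.
Proof.
apply: (@lin_span_linear _ _ _ _ _ _ (fun x => ratX K * x)) => [c y z|].
  by rewrite mulrDr scalerAr.
case=> [k|[i l]] /=; first by rewrite -exprS mem_span_ratX.
rewrite (ratX_lin_ratfun i) mulrDl -scalerAl mul1r.
rewrite exprS invfM mulVKf ?lin_ratfun_neq0 //.
by rewrite -invfM -exprS rpredD ?rpredZ ?mem_span_pole.
Qed.

Hypothesis a_uniq : uniq a.

(** Powers of [t] go by induction through [t = u i + a_i], and a pole at [a_i] gains one order. For
    a pole at another [a_j], the nonzero constant [a_j - a_i = u i - u j] lets the order at [a_j]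
    drop step by step. *)
Lemma span_mul_lin_ratfunV i x : x \in span -> (u i)^-1 * x \in span.
Proof.
apply: (@lin_span_linear _ _ _ _ _ _ (fun x => (u i)^-1 * x)) => [c y z|].
  by rewrite mulrDr scalerAr.
case=> [k|[j l]] /=.
  elim: k => [|k IHk]; first by rewrite mulr1; apply: (mem_span_pole i 1).
  rewrite exprS {1}(ratX_lin_ratfun i) mulrDl mulrDr mulKf ?lin_ratfun_neq0 //.
  by rewrite -scalerAl mul1r -scalerAr rpredD ?rpredZ ?mem_span_ratX.
have [->|ij] := eqVneq i j.
  by rewrite -invfM -exprS mem_span_pole.
pose d := tnth a j - tnth a i.
have d0 : d != 0.
  rewrite subr_eq0; apply: contra ij => /eqP aij.
  by apply/eqP/(tuple_uniqP a a_uniq).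
have uij z : d *: z = (u i - u j) * z.
  rewrite -mulr_algl /lin_ratfun /d scalerBl; congr (_ * _).
  by rewrite opprB [RHS]addrC addrA subrK.
have step m :
    (u i)^-1 * u j ^- m.+1 = d^-1 *: (u j ^- m.+1 - (u i)^-1 * u j ^- m).
  apply: (canRL (scalerK d0)).
  rewrite uij mulrBl mulVKf ?lin_ratfun_neq0 //; congr (_ - _).
  by rewrite mulrCA exprS invfM mulVKf ?lin_ratfun_neq0.
elim: l => [|l IHl]; rewrite step rpredZ ?rpredB ?mem_span_pole //.
by rewrite expr0 invr1 mulr1 (mem_span_pole i 1).
Qed.

(* The elements whose multiplication preserves the span form a subalgebra
   containing the generators. *)
Lemma gen_subalg_span x : x \in gen_subalg (Ra_gens a) -> x \in span.
Proof.
move=> /gen_subalgP xP.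
pose B : {pred ratfun K} :=
  fun x => `[< forall y, y \in span -> x * y \in span >].
have /asboolP/(_ 1 (mem_span_ratX 0)) : x \in B; last by rewrite mulr1.
apply: xP; first split.
- by apply/asboolP => y; rewrite mul1r.
- move=> c y z /asboolP yB /asboolP zB; apply/asboolP => w ws.
  by rewrite mulrDl -scalerAl rpredD ?rpredZ ?yB ?zB.
- move=> y z /asboolP yB /asboolP zB; apply/asboolP => w ws.
  by rewrite -mulrA yB ?zB.
move=> y [->|[i _ <-]]; apply/asboolP => z; first exact: span_mul_ratX.
exact: span_mul_lin_ratfunV.
Qed.

(** * The local rings at the points [a_i], and linear independence of the monomials *)

Definition regular_at i : {pred ratfun K} :=
  fun x => `[< exists p q, q.[tnth a i] != 0 /\ x = tofrac p / tofrac q >].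

Lemma horner_neq0 q (c : K) : q.[c] != 0 -> tofrac q != 0.
Proof. by rewrite tofrac_eq0; apply: contraNneq => ->; rewrite horner0. Qed.

Lemma regular_at_tofrac i p : tofrac p \in regular_at i.
Proof.
by apply/asboolP; exists p, 1; rewrite hornerC oner_neq0 tofrac1 divr1; split.
Qed.

Lemma regular_at_mul i x y :
  x \in regular_at i -> y \in regular_at i -> x * y \in regular_at i.
Proof.
move=> /asboolP[p [q [q0 ->]]] /asboolP[p' [q' [q'0 ->]]]; apply/asboolP.
exists (p * p'), (q * q'); rewrite hornerM mulf_neq0 // !tofracM; split=> //.
exact: (frac_mulE _ _ (horner_neq0 q0) (horner_neq0 q'0)).
Qed.

Lemma regular_at_submod_closed i : submod_closed (regular_at i).
Proof.
split=> [|c x y /asboolP[p [q [q0 ->]]] /asboolP[p' [q' [q'0 ->]]]].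
  by rewrite -tofrac0 regular_at_tofrac.
apply/asboolP; exists (c%:P * p * q' + p' * q), (q * q').
rewrite hornerM mulf_neq0 // tofracD !tofracM; split=> //.
exact: (frac_addE _ _ _ (horner_neq0 q0) (horner_neq0 q'0)).
Qed.

HB.instance Definition _ i :=
  GRing.isSubmodClosed.Build K (ratfun K) (regular_at i)
    (regular_at_submod_closed i).

Lemma regular_at_pole i j l : i != j -> u j ^- l \in regular_at i.
Proof.
move=> ij; apply/asboolP; exists 1, (('X - (tnth a j)%:P) ^+ l).
rewrite horner_exp hornerXsubC expf_neq0; last first.
  rewrite subr_eq0; apply: contra ij => /eqP aij.
  by apply/eqP/(tuple_uniqP a a_uniq).
by split=> //; rewrite lin_ratfunE tofracXn tofrac1 div1r.
Qed.

(** Clearing the denominator gives [c q = (X - a_i) p]; evaluation at [a_i], where [q] does not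
    vanish, forces [c = 0]. *)
Lemma regular_at_const i (c : K) x :
  x \in regular_at i -> c%:A = u i * x -> c = 0.
Proof.
move=> /asboolP[p [q [q0 ->]]] e.
have /eqP : tofrac (c%:P * q) = tofrac (('X - (tnth a i)%:P) * p) :> ratfun K.
  rewrite !tofracM -lin_ratfunE.
  have -> : tofrac c%:P = c%:A :> ratfun K by rewrite [RHS]mulr1.
  by rewrite e -mulrA divfK ?(horner_neq0 q0).
rewrite tofrac_eq => /eqP/(congr1 (horner^~ (tnth a i))).
rewrite !hornerM hornerC hornerXsubC subrr mul0r => /eqP.
by rewrite mulf_eq0 (negPf q0) orbF => /eqP.
Qed.


Lemma Ra_monom_pole_free (s : seq (nat + 'I_n * nat))
    (c : nat + 'I_n * nat -> K) :
    uniq s -> \sum_(j <- s) c j *: Ra_monom a j = 0 ->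
  forall i (l : nat), inr (i, l) \in s -> c (inr (i, l)) = 0.
Proof.
move=> s_uniq sum0 i l ls; apply/eqP; apply: contraT => cl0.
(* The index [m] stands for a pole of order [m + 1]. The largest [m] with a nonzero coefficient is
   chosen below and contradicted. *)
pose P m := (inr (i, m) \in s) && (c (inr (i, m)) != 0).
pose ord (j : nat + 'I_n * nat) := if j is inr (_, m) then m else 0%N.
have exP : exists m, P m by exists l; rewrite /P ls.
have boundP m : P m -> (m <= \max_(j <- s) ord j)%N.
  case/andP=> ms _.
  exact: (@leq_bigmax_seq _ _ xpredT ord (inr (i, m))) ms _.
have [m /andP[ms cm0] maxm] := ex_maxnP exP boundP.
suff : c (inr (i, m)) == 0 by rewrite (negPf cm0).
move: sum0; rewrite (bigD1_seq _ ms s_uniq) /= => sum0.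
set rest := (X in _ + X) in sum0.
have um0 : u i ^+ m.+1 != 0 by rewrite expf_neq0 ?lin_ratfun_neq0.
(* The relation multiplied by [u i ^+ m.+1] equates the leading coefficient with [u i] times this
   witness. Regularity of the witness is then checked term by term. *)
apply/eqP/(@regular_at_const i _ (- (u i ^+ m * rest))); last first.
  rewrite mulrN mulrA -exprS.
  move/(congr1 ( *%R (u i ^+ m.+1))): sum0.
  rewrite mulr0 mulrDr -scalerAr mulfV // => /eqP.
  by rewrite addr_eq0 => /eqP.
rewrite rpredN /rest mulr_sumr big_seq_cond rpred_sum // => j /andP[js jm].
rewrite -scalerAr.
case: j js jm => [k _ _|[j k] js jm] /=.
  rewrite rpredZ // lin_ratfunE /ratX -!tofracXn -tofracM.
  exact: regular_at_tofrac.
have [eij|ij] := eqVneq i j; last first.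
  rewrite rpredZ // regular_at_mul ?regular_at_pole //.
  by rewrite lin_ratfunE -tofracXn regular_at_tofrac.
case: eij js jm => <- js jm.
(* For another pole at the same point, either the coefficient is zero or maximality gives [k < m],
   and then [u i ^+ m] cancels the pole. *)
have [->|ck] := eqVneq (c (inr (i, k))) 0; first by rewrite scale0r rpred0.
have km : (k < m)%N.
  rewrite ltn_neqAle maxm ?/P ?js // andbT.
  by apply: contra jm => /eqP ->.
rewrite rpredZ // -(subnK km) exprD mulfK ?expf_neq0 ?lin_ratfun_neq0 //.
by rewrite lin_ratfunE -tofracXn regular_at_tofrac.
Qed.

Lemma Ra_monom_free (s : seq (nat + 'I_n * nat))
    (c : nat + 'I_n * nat -> K) :
    uniq s -> \sum_(j <- s) c j *: Ra_monom a j = 0 ->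
  forall b : nat + 'I_n * nat, b \in s -> c b = 0.
Proof.
move=> s_uniq sum0.
have pole0 := Ra_monom_pole_free s_uniq sum0.
case=> [k|[i l]]; last exact: pole0.
move=> ks.
(* With all pole coefficients zero, the relation is the image of a polynomial, whose coefficients
   can be compared. *)
pose f (j : nat + 'I_n * nat) : {poly K} :=
  if j is inl m then c j *: 'X^m else 0.
have /eqP : tofrac (\sum_(j <- s) f j) = 0 :> ratfun K.
  rewrite -[RHS]sum0 rmorph_sum /= big_seq [RHS]big_seq.
  apply: eq_bigr => -[m|[i l]] js /=; last first.
    by rewrite tofrac0 pole0 ?scale0r.
  by rewrite -mul_polyC tofracM tofracXn.
rewrite tofrac_eq0 => /eqP/(congr1 (fun p : {poly K} => p`_k)).
rewrite coef0 coef_sum (bigD1_seq _ ks s_uniq) /= coefZ coefXn eqxx mulr1.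
rewrite big1 ?addr0 // => -[m|[i l]] /= mk; last by rewrite coef0.
rewrite coefZ coefXn (_ : (k == m) = false) ?mulr0 //.
by apply: contraNF mk => /eqP ->.
Qed.

Lemma val_sum_Ra_basis (s : seq (nat + 'I_n * nat))
    (c : nat + 'I_n * nat -> K) :
  subalg_val (\sum_(j <- s) c j *: Ra_basis a j)
  = \sum_(j <- s) c j *: Ra_monom a j.
Proof. by elim/big_ind2: _ => // _ x _ y <- <-. Qed.

Lemma Ra_basisP : is_basis (Ra_basis a).
Proof.
split=> [s c s_uniq sum0|x].
  apply: (Ra_monom_free s_uniq).
  by rewrite -val_sum_Ra_basis sum0.
have [s [c e]] := lin_spanP (gen_subalg_span (subalg_valP x)).
by exists s, c; apply: val_inj; rewrite /= val_sum_Ra_basis.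
Qed.

End SubalgebraOfFractions.

(** * Derivations of an algebra given by generators *)

Section Derivations.
Variables (K : fieldType) (A : comAlgType K).
Implicit Types (D : Der A) (x y : A).

Lemma der_linear D : linear D.
Proof. by have /is_derivationP[] := derP D. Qed.

Lemma derM D x y : D (x * y) = D x * y + x * D y.
Proof. by have /is_derivationP[] := derP D. Qed.

Lemma der1 D : D 1 = 0.
Proof.
by apply: (@addrI _ (D 1)); rewrite addr0 -{3}[1]mulr1 derM mulr1 mul1r.
Qed.

(** The product rule on [y * x = 1] gives [D y * x = 0], and [x] can be cancelled by multiplying
    with [y]. *)
Lemma der_inverse_eq0 D x y : y * x = 1 -> D x = 0 -> D y = 0.
Proof.
move=> yx1 Dx0; rewrite -[D y]mulr1 -yx1 mulrA mulrAC.
have := der1 D; rewrite -yx1 derM Dx0 mulr0 addr0 => ->.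
by rewrite mul0r.
Qed.

Lemma der_sumE (J : Type) (s : seq J) (D : J -> Der A) x :
  (\sum_(j <- s) D j) x = \sum_(j <- s) D j x.
Proof.
elim: s => [|j s IHs]; first by rewrite !big_nil.
by rewrite !big_cons -IHs.
Qed.

End Derivations.

Lemma der_gen_subalg_eq0 (K : fieldType) (A : comAlgType K) (S : set A)
    (D : Der (subalg_of S)) :
  (forall y (Sy : S y), D (SubalgOf (mem_gen_subalg Sy)) = 0) ->
  forall x, D x = 0.
Proof.
move=> DS [x xS].
(* Minimality of the generated subalgebra concerns subsets of [A], whereas [D] lives on the
   subalgebra; hence the image in [A] of the kernel of [D]. *)
pose B : {pred A} := fun x => `[< exists2 y, subalg_val y = x & D y = 0 >].
have /asboolP[y yx Dy] : x \in B.
  move/gen_subalgP: (xS); apply; first split.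
  - by apply/asboolP; exists 1; rewrite ?der1.
  - move=> c _ _ /asboolP[y <- y0] /asboolP[z <- z0]; apply/asboolP.
    by exists (c *: y + z); rewrite // der_linear y0 z0 scaler0 addr0.
  - move=> _ _ /asboolP[y <- y0] /asboolP[z <- z0]; apply/asboolP.
    by exists (y * z); rewrite // derM y0 z0 mulr0 mul0r addr0.
  - move=> y Sy; apply/asboolP.
    by exists (SubalgOf (mem_gen_subalg Sy)); rewrite // DS.
by rewrite -Dy; congr (D _); apply: val_inj.
Qed.

(** * The basis of [Der R_a], through evaluation at [t] *)

Section DerivationsOfRa.
Variables (K : fieldType) (n : nat) (a : n.-tuple K).
Local Notation t := (Ra_basis a (inl 1%N)).

Lemma Va_basis_t j : Va_basis a j t = Ra_basis a j.
Proof.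
apply: val_inj => /=.
by rewrite expr1 ratderiv_ratX mulr1.
Qed.

Lemma der_Ra_eq0 (D : Va a) : D t = 0 -> D = 0.
Proof.
move=> Dt0; apply: val_inj; apply/funext => x /=.
apply: der_gen_subalg_eq0 => y Sy; have [yt|[i _ yi]] := Sy.
  by rewrite -[RHS]Dt0; congr (D _); apply: val_inj.
(* The generator is the inverse of [t - a_i], written here in the shape to which linearity of [D]
   applies directly. *)
apply: (@der_inverse_eq0 _ _ _ (- tnth a i *: 1 + t)).
  apply: val_inj => /=.
  rewrite -yi expr1 scaleNr addrC.
  exact: mulVf (lin_ratfun_neq0 a i).
by rewrite der_linear der1 Dt0 scaler0 addr0.
Qed.

(** Evaluation at [t] is linear, injective on derivations, and carries [Va_basis] to [Ra_basis], so
    both independence and spanning transfer. *)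
Lemma Va_basisP : uniq a -> is_basis (Va_basis a).
Proof.
move=> a_uniq; have [Ra_free Ra_gen] := Ra_basisP a_uniq.
have sum_t s c :
    (\sum_(j <- s) c j *: Va_basis a j) t = \sum_(j <- s) c j *: Ra_basis a j.
  rewrite der_sumE; apply: eq_bigr => j _.
  by rewrite -[in RHS]Va_basis_t.
split=> [s c s_uniq sum0|D].
  by apply: Ra_free; rewrite // -sum_t sum0.
have [s [c Dt]] := Ra_gen (D t); exists s, c.
apply/eqP; rewrite -subr_eq0; apply/eqP/der_Ra_eq0.
set E := \sum_(j <- s) _; have -> : (D - E) t = D t - E t by [].
by rewrite sum_t -Dt subrr.
Qed.

End DerivationsOfRa.

(** * The group of units of [R_a] *)

Section UnitsOfRa.
Variables (K : fieldType) (n : nat) (a : n.-tuple K).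
Implicit Types (i : 'I_n) (x y : ratfun K) (p q : {poly K}).
Local Notation u := (lin_ratfun a).

Definition lin_ratfun_monom : set (ratfun K) :=
  [set x | exists (c : K) (k : 'I_n -> int),
     c != 0 /\ x = c *: \prod_(i < n) u i ^ k i].

Lemma lin_ratfun_monomC c : c != 0 -> lin_ratfun_monom c%:A.
Proof.
by move=> c0; exists c, (fun=> 0); rewrite big1.
Qed.

Lemma lin_ratfun_monomM x y :
  lin_ratfun_monom x -> lin_ratfun_monom y -> lin_ratfun_monom (x * y).
Proof.
move=> [c [k [c0 ->]]] [d [l [d0 ->]]]; exists (c * d), (fun i => k i + l i).
rewrite mulf_neq0 // -scalerAl -scalerAr scalerA -big_split; split=> //.
by congr (_ *: _); apply: eq_bigr => i _; rewrite expfzDr ?lin_ratfun_neq0.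
Qed.

Lemma lin_ratfun_monomV x : lin_ratfun_monom x -> lin_ratfun_monom x^-1.
Proof.
move=> [c [k [c0 ->]]]; exists c^-1, (fun i => - k i); rewrite invr_eq0.
split=> //; rewrite invrZ ?unitfE // -?prodfV; last first.
  by apply/prodf_neq0 => i _; rewrite expfz_neq0 ?lin_ratfun_neq0.
by congr (_ *: _); apply: eq_bigr => i _; rewrite invr_expz.
Qed.

Lemma lin_ratfun_monom_lin i : lin_ratfun_monom (u i).
Proof.
exists 1, (fun j => (j == i)%:Z); rewrite oner_neq0 scale1r; split=> //.
by rewrite (bigD1 i) //= eqxx expr1z big1 ?mulr1 // => j /negPf ->.
Qed.

Lemma lin_ratfun_monom_prod (J : Type) (r : seq J) (F : J -> 'I_n) :
  lin_ratfun_monom (\prod_(j <- r) u (F j)).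
Proof.
elim/big_ind: _ => [|x y|j _].
- by rewrite -[1]scale1r; apply/lin_ratfun_monomC/oner_neq0.
- exact: lin_ratfun_monomM.
- exact: lin_ratfun_monom_lin.
Qed.

Lemma lin_ratfun_monom_invertible x :
  lin_ratfun_monom x -> exists2 v : Ra a, invertible v & subalg_val v = x.
Proof.
have memR y : lin_ratfun_monom y -> y \in gen_subalg (Ra_gens a).
  move=> [c [k [c0 ->]]]; rewrite rpredZ // rpred_prod // => i _.
  case: (k i) => m; last first.
    by rewrite /exprz -exprVn rpredX //; apply: mem_gen_subalg; right; exists i.
  rewrite rpredX // /lin_ratfun rpredB ?rpredZ ?rpred1 //.
  by apply: mem_gen_subalg; left.
move=> xM; exists (SubalgOf (memR _ xM)) => //.
exists (SubalgOf (memR _ (lin_ratfun_monomV xM))).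
apply: val_inj => /=; apply: mulfV.
case: xM => c [k [c0 ->]]; rewrite scaler_eq0 negb_or c0.
by apply/prodf_neq0 => i _; rewrite expfz_neq0 ?lin_ratfun_neq0.
Qed.

Definition pole_poly : {poly K} := \prod_(i < n) ('X - (tnth a i)%:P).

Lemma pole_polyX_neq0 m : tofrac (pole_poly ^+ m) != 0 :> ratfun K.
Proof.
rewrite tofrac_eq0 expf_neq0 //.
by apply/prodf_neq0 => i _; rewrite polyXsubC_eq0.
Qed.

(** Fractions whose denominator is a power of [pole_poly] form a subalgebra containing the
    generators. *)
Lemma gen_subalg_denom x : x \in gen_subalg (Ra_gens a) ->
  exists p m, x = tofrac p / tofrac (pole_poly ^+ m).
Proof.
move=> /gen_subalgP xP.
pose B : {pred ratfun K} :=
  fun x => `[< exists p m, x = tofrac p / tofrac (pole_poly ^+ m) >].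
have poly_B p : tofrac p \in B.
  by apply/asboolP; exists p, 0%N; rewrite expr0 tofrac1 divr1.
apply/asboolP/(xP B); first split.
- by rewrite -tofrac1 poly_B.
- move=> c _ _ /asboolP[p [m ->]] /asboolP[p' [m' ->]]; apply/asboolP.
  exists (c%:P * p * pole_poly ^+ m' + p' * pole_poly ^+ m), (m + m')%N.
  rewrite exprD tofracD !tofracM.
  exact: (frac_addE _ _ _ (pole_polyX_neq0 m) (pole_polyX_neq0 m')).
- move=> _ _ /asboolP[p [m ->]] /asboolP[p' [m' ->]]; apply/asboolP.
  exists (p * p'), (m + m')%N; rewrite exprD !tofracM.
  exact: (frac_mulE _ _ (pole_polyX_neq0 m) (pole_polyX_neq0 m')).
- move=> y [->|[i _ <-]]; first exact: poly_B.
  (* The inverse of [t - a_i] is expanded by the remaining factors to have denominator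
     [pole_poly]. *)
  apply/asboolP; exists (\prod_(j < n | j != i) ('X - (tnth a j)%:P)), 1%N.
  have := pole_polyX_neq0 1; rewrite expr1 /pole_poly (bigD1 i) //= tofracM.
  rewrite mulf_eq0 negb_or -lin_ratfunE => /andP[u0 r0].
  by rewrite invfM mulrCA mulfV ?mulr1.
Qed.

Lemma invertible_lin_ratfun_monom (v : Ra a) :
  invertible v -> lin_ratfun_monom (subalg_val v).
Proof.
move=> [w /(congr1 (@subalg_val _ _ _))] /=.
have [p [m ->]] := gen_subalg_denom (subalg_valP v).
have [p' [m' ->]] := gen_subalg_denom (subalg_valP w).
rewrite (frac_mulE _ _ (pole_polyX_neq0 m) (pole_polyX_neq0 m')).
rewrite -!tofracM -exprD => /(canRL (mulfVK (pole_polyX_neq0 _))).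
rewrite mul1r => /eqP; rewrite tofrac_eq => /eqP pp'.
(* The power is flattened to a single product of linear factors over pairs, the form needed to
   describe its divisors. *)
have polyE k : pole_poly ^+ k
    = \prod_(z : 'I_k * 'I_n) ('X - (tnth a z.2)%:P).
  by rewrite -(pair_bigA _ (fun _ i => 'X - (tnth a i)%:P)) /=
    prodr_const card_ord.
have tofrac_prod (J : Type) (r : seq J) (F : J -> 'I_n) :
    tofrac (\prod_(j <- r) ('X - (tnth a (F j))%:P)) = \prod_(j <- r) u (F j).
  by rewrite rmorph_prod; apply: eq_bigr => j _; rewrite lin_ratfunE.
apply: lin_ratfun_monomM; last first.
  by rewrite polyE tofrac_prod; apply/lin_ratfun_monomV/lin_ratfun_monom_prod.
have : p %| pole_poly ^+ (m + m') by rewrite -pp' dvdp_mulr.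
(* A divisor of a product of linear factors is associate to a subproduct, selected by the mask [b];
   [c] and [d] are the nonzero scalars of the association. *)
rewrite polyE => /dvdp_prod_XsubC[b /eqpP[[c d] /= /andP[c0 d0] e]].
have -> : p = (c^-1 * d)%:P *
    \prod_(z <- mask b (index_enum ('I_(m + m') * 'I_n)%type))
      ('X - (tnth a z.2)%:P).
  by rewrite mul_polyC -scalerA -e scalerK.
rewrite tofracM tofrac_prod; apply: lin_ratfun_monomM.
  rewrite -[tofrac _]mulr1; apply: lin_ratfun_monomC.
  by rewrite mulf_neq0 ?invr_eq0.
exact: lin_ratfun_monom_prod.
Qed.

End UnitsOfRa.

Unset Implicit Arguments.

Theorem lemma1 (R : realType) (n : nat) (n_gt0 : (0 < n)%N)
    (a : n.-tuple R[i]) (a_uniq : uniq a) :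
  [/\ is_basis (Ra_basis a : nat + 'I_n * nat -> Ra a),
      is_basis (Va_basis a : nat + 'I_n * nat -> Va a)
    & [set subalg_val u | u in (invertible : set (Ra a))] =
      [set f : ratfun R[i] | exists (c : R[i]) (k : 'I_n -> int),
         c != 0 /\ f = c *: \prod_(i < n) (ratX R[i] - (tnth a i)%:A) ^ k i] ].
Proof.
split; [exact: Ra_basisP | exact: Va_basisP |].
apply/seteqP; split=> [_ [v vU <-]|f].
  exact: invertible_lin_ratfun_monom.
by move=> /lin_ratfun_monom_invertible[v vU <-]; exists v.
Qed.
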